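(* Let $n\ge3$ and let $\mathfrak{g}=P(n-1)$ be the Lie superalgebra of complex matrices $\begin{pmatrix}A&B\\ C&-A^t\end{pmatrix}$ with $A,B,C\in M_n(\mathbb{C})$, $\operatorname{trace}(A)=0$, $B^t=B$, $C^t=-C$, so $\mathfrak{g}_0\cong\mathfrak{sl}(n)$ via the block $A$. Let $\mu$ be a partition of $n$, let $J_\mu$ be the nilpotent $n\times n$ Jordan matrix with Jordan blocks of sizes $\mu_1\ge\mu_2\ge\cdots$ arranged in this order, with nonzero entries immediately below the main diagonal, and for $1\le i\le n-1$ let $b_i\in\{0,1\}$ be the entry of $J_\mu$ in row $i+1$, column $i$. Let $\mathcal{O}_\mu$ be the orbit of $J_\mu$ in $\mathfrak{g}_0$. Then $$k(\mathcal{O}_\mu)=2\sum_{i=1}^{n-1}(n-i)b_i=n^2-\sum_i(\mu_i')^2.$$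
   Context: The $\mathbb{Z}_2$-grading: the even part consists of matrices with $B=C=0$, the odd part of those with $A=0$. The dual partition is $\mu'_i=|\{j:\mu_j\ge i\}|$. Definition of $k$. For a finite dimensional Lie superalgebra $\mathfrak{g}=\mathfrak{g}_0\oplus\mathfrak{g}_1$ over $\mathbb{C}$ with basis $v_1,\dots,v_N$ of $\mathfrak{g}_1$, let $M(\mathfrak{g})=([v_i,v_j])_{i,j}$, a symmetric matrix with entries in $\mathfrak{g}_0\subset S(\mathfrak{g}_0)$. For a prime ideal $q$ of $S(\mathfrak{g}_0)$, $k(q)$ is the rank of $M(\mathfrak{g})$ modulo $q$, as a matrix over the fraction field of $S(\mathfrak{g}_0)/q$. Identify $\mathfrak{g}_0$ with $\mathfrak{g}_0^*$ using a nondegenerate invariant bilinear form on $\mathfrak{g}_0$, so that elements of $S(\mathfrak{g}_0)$ are functions on $\mathfrak{g}_0$. For a nilpotent orbit $\mathcal{O}\subset\mathfrak{g}_0$, $k(\mathcal{O}):=k(q)$, where $q$ is the prime ideal of functions in $S(\mathfrak{g}_0)$ vanishing on $\mathcal{O}$. *)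

(* Defs.v *)
From HB Require Import structures.
From mathcomp Require Import all_boot all_order all_algebra.
From mathcomp Require Import ring.
From mathcomp Require Import boolp reals.
From mathcomp Require Import complex.
From mathcomp Require Import mpoly.
From mathcomp Require Import ring_quotient.

Set Implicit Arguments.
Unset Strict Implicit.
Unset Printing Implicit Defensive.

Import Order.TTheory GRing.Theory Num.Theory.
Local Open Scope ring_scope.
Local Open Scope quotient_scope.

(* The quotient by a prime ideal as an integral domain; the library provides   *)
(* the commutative ring {ideal_quot q}.                                        *)
Section PrimeQuotient.
Variables (R : comNzRingType) (q : prime_idealr R).
Local Notation Q := {ideal_quot q}.

Definition quot_unit : pred Q := fun x => `[< exists y, y * x == 1 >].

Definition quot_inv (x : Q) : Q :=
  if pselect (exists y, y * x == 1) is left h then xchoose h else x.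

Lemma quot_mulVr : {in quot_unit, left_inverse 1 quot_inv *%R}.
Proof.
move=> x /asboolP hx; rewrite /quot_inv; case: pselect => // h.
exact/eqP/(xchooseP h).
Qed.

Lemma quot_unitP (x y : Q) : y * x = 1 -> x \in quot_unit.
Proof. by move=> h; apply/asboolP; exists y; apply/eqP. Qed.

Lemma quot_inv_out : {in [predC quot_unit], quot_inv =1 id}.
Proof.
by move=> x /asboolP hx; rewrite /quot_inv; case: pselect => // h; case: hx.
Qed.

HB.instance Definition _ := GRing.ComNzRing_hasMulInverse.Build Q
  quot_mulVr quot_unitP quot_inv_out.

HB.instance Definition _ := GRing.ComUnitRing_isIntegral.Build Q
  (@Quotient.rquot_IdomainAxiom R q).
End PrimeQuotient.

(* A finite dimensional Lie superalgebra g = g_0 (+) g_1, presented inside an  *)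
(* ambient space V that carries the bracket: lsa_part false is g_0 and         *)
(* lsa_part true is g_1.  The bracket is only meaningful on these subspaces.   *)
Record lieSuperalgebra (F : fieldType) := LieSuperalgebra {
  lsa_space :> vectType F;
  lsa_part : bool -> {vspace lsa_space};
  lsa_br : lsa_space -> lsa_space -> lsa_space;
  lsa_part_direct : (lsa_part false :&: lsa_part true = 0)%VS;
  lsa_br_linearl : forall y, linear (lsa_br^~ y);
  lsa_br_linearr : forall x, linear (lsa_br x);
  lsa_br_part : forall i j x y, x \in lsa_part i -> y \in lsa_part j ->
    lsa_br x y \in lsa_part (i (+) j);
  lsa_br_antisym : forall i j x y, x \in lsa_part i -> y \in lsa_part j ->
    lsa_br x y = - ((-1) ^+ (i && j) *: lsa_br y x);
  lsa_br_jacobi : forall i j k x y z,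
    x \in lsa_part i -> y \in lsa_part j -> z \in lsa_part k ->
    lsa_br x (lsa_br y z)
      = lsa_br (lsa_br x y) z + (-1) ^+ (i && j) *: lsa_br y (lsa_br x z)
}.

Section KRank.
Variables (F : fieldType) (g : lieSuperalgebra F).
Local Notation g0 := (lsa_part g false).
Local Notation g1 := (lsa_part g true).

(* S(g_0), with the basis vbasis g0 as the generators 'X_i. *)
Local Notation symalg := {mpoly F[\dim g0]}.

Definition sym_of (x : g) : symalg :=
  \sum_(i < \dim g0) coord (vbasis g0) i x *: 'X_i.

Definition bracket_mx : 'M[symalg]_(\dim g1) :=
  \matrix_(i, j) sym_of (lsa_br (vbasis g1)`_i (vbasis g1)`_j).

Definition mod_frac (q : prime_idealr symalg) (f : symalg) :
    {fraction {ideal_quot q}} := tofrac (\pi_({ideal_quot q}) f).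

Definition k_ideal (q : prime_idealr symalg) : nat :=
  \rank (map_mx (mod_frac q) bracket_mx).

Record invariant_form := InvariantForm {
  form_fun :> g -> g -> F;
  form_linearl : {in g0 & &, forall x y z,
    forall a, form_fun (a *: x + y) z = a * form_fun x z + form_fun y z};
  form_linearr : {in g0 & &, forall x y z,
    forall a, form_fun z (a *: x + y) = a * form_fun z x + form_fun z y};
  form_invariant : {in g0 & &, forall x y z,
    form_fun (lsa_br x y) z = form_fun x (lsa_br y z)};
  form_nondegenerate : {in g0, forall x,
    {in g0, forall y, form_fun x y = 0} -> x = 0}
}.

(* f as a function on g_0: the generator x becomes y |-> (x, y). *)
Definition sym_fun (B : invariant_form) (f : symalg) (y : g) : F :=
  f.@[fun i => B (vbasis g0)`_i y].

Definition vanishing (B : invariant_form) (O : g -> Prop) : {pred symalg} :=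
  fun f => `[< forall y, O y -> sym_fun B f y = 0 >].

Lemma vanishing_ideal B O : (exists y, O y) -> idealr_closed (vanishing B O).
Proof.
move=> [y0 Oy0]; split.
- by apply/asboolP => y _; rewrite /sym_fun meval0.
- apply/asboolP => /(_ _ Oy0)/eqP; by rewrite /sym_fun meval1 oner_eq0.
- move=> a u v /asboolP Hu /asboolP Hv; apply/asboolP => y Oy.
  have := Hu _ Oy; have := Hv _ Oy; rewrite /sym_fun mevalD mevalM => -> ->.
  by rewrite mulr0 addr0.
Qed.

Definition vanishing_prime (B : invariant_form) (O : g -> Prop)
    (O_neq0 : exists y, O y) (O_irr : prime_idealr_closed (vanishing B O)) :
  prime_idealr symalg :=
  HB.pack (vanishing B O : symalg -> bool)
    (isIdealr.Build symalg (vanishing B O) (vanishing_ideal B O_neq0))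
    (isPrimeIdealrClosed.Build symalg (vanishing B O) O_irr).

Definition k_orbit (B : invariant_form) (O : g -> Prop)
    (O_neq0 : exists y, O y) (O_irr : prime_idealr_closed (vanishing B O)) : nat :=
  k_ideal (vanishing_prime O_neq0 O_irr).

End KRank.

Section Periplectic.
Variables (F : numFieldType) (n : nat).
Local Notation gl := 'M[F]_(n + n).

(* The grading of gl(n|n), and its supercommutator
   [X, Y] = X Y - (-1)^(|X||Y|) Y X extended bilinearly. *)
Definition gl_proj (i : bool) (X : gl) : gl :=
  if i then block_mx 0 (ursubmx X) (dlsubmx X) 0
  else block_mx (ulsubmx X) 0 0 (drsubmx X).

Definition superbr (X Y : gl) : gl :=
  \sum_(i : bool) \sum_(j : bool)
    (gl_proj i X *m gl_proj j Y
     - (-1) ^+ (i && j) *: (gl_proj j Y *m gl_proj i X)).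

Definition gl_part_eqs (i : bool) (X : gl) : ('M[F]_n * 'M[F]_n)%type :=
  if i then (ulsubmx X, drsubmx X) else (ursubmx X, dlsubmx X).

Lemma gl_part_eqs_linear i : linear (gl_part_eqs i).
Proof.
by move=> a X Y; rewrite /gl_part_eqs; case: i; congr pair; apply/matrixP=> r c;
  rewrite !mxE.
Qed.
HB.instance Definition _ i :=
  GRing.isLinear.Build F gl ('M[F]_n * 'M[F]_n)%type _ (gl_part_eqs i)
    (gl_part_eqs_linear i).

Definition gl_part (i : bool) : {vspace gl} := lker (linfun (gl_part_eqs i)).

Definition periplectic_eqs (X : gl) :
    (F^o * 'M[F]_n * 'M[F]_n * 'M[F]_n)%type :=
  (\tr (ulsubmx X), drsubmx X + (ulsubmx X)^T,
   ursubmx X - (ursubmx X)^T, dlsubmx X + (dlsubmx X)^T).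

Lemma periplectic_eqs_linear : linear periplectic_eqs.
Proof.
move=> a X Y; rewrite /periplectic_eqs; congr (_, _, _, _).
- have -> : ulsubmx (a *: X + Y) = a *: ulsubmx X + ulsubmx Y.
    by apply/matrixP=> r c; rewrite !mxE.
  by rewrite mxtraceD mxtraceZ.
all: by apply/matrixP=> r c; rewrite !mxE; ring.
Qed.
HB.instance Definition _ :=
  GRing.isLinear.Build F gl (F^o * 'M[F]_n * 'M[F]_n * 'M[F]_n)%type _
    periplectic_eqs periplectic_eqs_linear.

Definition periplectic_space : {vspace gl} := lker (linfun periplectic_eqs).

Definition periplectic_part (i : bool) : {vspace gl} :=
  (periplectic_space :&: gl_part i)%VS.

Lemma mem_gl_part i X : (X \in gl_part i) = (gl_proj i X == X).
Proof.
rewrite memv_ker lfunE /= /gl_part_eqs /gl_proj.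
case: i; rewrite -[X in _ = (_ == X)]submxK; apply/eqP/eqP.
- by case=> -> ->.
- by case/eq_block_mx => <- _ _ <-.
- by case=> -> ->.
- by case/eq_block_mx => _ <- <- _.
Qed.

Lemma mem_periplectic_space X :
  X \in periplectic_space <->
  exists A B C : 'M[F]_n, [/\ X = block_mx A B C (- A^T),
    \tr A = 0, B^T = B & C^T = - C].
Proof.
rewrite memv_ker lfunE /= /periplectic_eqs; split.
  move=> /eqP[trA drE urE dlE]; exists (ulsubmx X), (ursubmx X), (dlsubmx X).
  split=> //.
  - by rewrite -{1}[X]submxK; congr block_mx; apply/eqP; rewrite -addr_eq0 drE.
  - by apply/esym/eqP; rewrite -subr_eq0 urE.
  - by apply/eqP; rewrite -addr_eq0 addrC dlE.
move=> [A [B [C [-> trA BT CT]]]].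
rewrite block_mxKul block_mxKur block_mxKdl block_mxKdr trA BT CT.
by rewrite addNr !subrr.
Qed.

Definition periplectic_even (A : 'M[F]_n) : gl := block_mx A 0 0 (- A^T).

Lemma mem_periplectic_even X :
  X \in periplectic_part false <->
  exists2 A, \tr A = 0 & X = periplectic_even A.
Proof.
rewrite memv_cap mem_gl_part; split.
  move=> /andP[/mem_periplectic_space[A [B [C [XE trA _ _]]]] /eqP eX].
  exists A => //; rewrite -eX XE /gl_proj.
  by rewrite block_mxKul block_mxKdr.
move=> [A trA ->]; apply/andP; split.
  by apply/mem_periplectic_space; exists A, 0, 0; rewrite !trmx0 oppr0.
by rewrite /gl_proj block_mxKul block_mxKdr.
Qed.

Lemma mem_periplectic_odd X :
  X \in periplectic_part true <->
  exists B C, [/\ B^T = B, C^T = - C & X = block_mx 0 B C 0].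
Proof.
rewrite memv_cap mem_gl_part; split.
  move=> /andP[/mem_periplectic_space[A [B [C [XE trA BT CT]]]] /eqP eX].
  exists B, C; split => //; rewrite -eX XE /gl_proj.
  by rewrite block_mxKur block_mxKdl.
move=> [B [C [BT CT ->]]]; apply/andP; split.
  by apply/mem_periplectic_space; exists 0, B, C; rewrite trmx0 oppr0 mxtrace0.
by rewrite /gl_proj block_mxKur block_mxKdl.
Qed.

Lemma gl_proj0 i j X : X \in gl_part i -> i != j -> gl_proj j X = 0.
Proof.
rewrite mem_gl_part => /eqP <-; case: i; case: j => // _; rewrite /gl_proj.
  by rewrite block_mxKul block_mxKdr block_mx0.
by rewrite block_mxKur block_mxKdl block_mx0.
Qed.

Lemma superbrE i j X Y : X \in gl_part i -> Y \in gl_part j ->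
  superbr X Y = X *m Y - (-1) ^+ (i && j) *: (Y *m X).
Proof.
move=> hX hY; rewrite /superbr (bigD1 i) //= [X in _ + X]big1; last first.
  move=> i' ii'; rewrite big1 // => j' _.
  by rewrite (gl_proj0 hX) 1?eq_sym // mul0mx mulmx0 scaler0 subrr.
rewrite addr0 (bigD1 j) //= [X in _ + X]big1; last first.
  move=> j' jj'.
  by rewrite (gl_proj0 hY) 1?eq_sym // mul0mx mulmx0 scaler0 subrr.
move: hX hY; rewrite !mem_gl_part => /eqP -> /eqP ->.
by rewrite addr0.
Qed.

Lemma gl_proj_linear i : linear (gl_proj i).
Proof.
move=> a X Y; rewrite /gl_proj; case: i; rewrite scale_block_mx add_block_mx;
  rewrite ?scaler0 ?addr0; congr block_mx; by apply/matrixP=> r c; rewrite !mxE.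
Qed.

Lemma superbr_linearl Y : linear (superbr^~ Y).
Proof.
move=> a X X'; rewrite /superbr scaler_sumr -big_split; apply: eq_bigr => i _.
rewrite scaler_sumr -big_split; apply: eq_bigr => j _ /=.
rewrite gl_proj_linear mulmxDl mulmxDr -scalemxAl -scalemxAr.
rewrite scalerDr !scalerBr !scalerA [_ * a]mulrC opprD.
exact: addrACA.
Qed.

Lemma superbr_linearr X : linear (superbr X).
Proof.
move=> a Y Y'; rewrite /superbr scaler_sumr -big_split; apply: eq_bigr => i _.
rewrite scaler_sumr -big_split; apply: eq_bigr => j _ /=.
rewrite gl_proj_linear mulmxDl mulmxDr -scalemxAl -scalemxAr.
rewrite scalerDr !scalerBr !scalerA [_ * a]mulrC opprD.
exact: addrACA.
Qed.

Lemma superbr_gl_part i j X Y : X \in gl_part i -> Y \in gl_part j ->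
  superbr X Y \in gl_part (i (+) j).
Proof.
move=> hX hY; rewrite (superbrE hX hY).
apply: memvB; last apply: memvZ.
all: move: hX hY; rewrite !mem_gl_part => /eqP <- /eqP <-.
all: case: i; case: j; rewrite /gl_proj /= !mulmx_block;
  rewrite !(mul0mx, mulmx0, addr0, add0r);
  by rewrite ?block_mxKul ?block_mxKur ?block_mxKdl ?block_mxKdr.
Qed.

Lemma superbr_antisym i j X Y : X \in gl_part i -> Y \in gl_part j ->
  superbr X Y = - ((-1) ^+ (i && j) *: superbr Y X).
Proof.
move=> hX hY; rewrite (superbrE hX hY) (superbrE hY hX) andbC.
by case: (j && i); rewrite ?expr1 ?expr0 ?scaleN1r ?scale1r ?opprK ?opprB // addrC.
Qed.

Lemma superbr_jacobi i j k X Y Z :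
  X \in gl_part i -> Y \in gl_part j -> Z \in gl_part k ->
  superbr X (superbr Y Z)
    = superbr (superbr X Y) Z + (-1) ^+ (i && j) *: superbr Y (superbr X Z).
Proof.
move=> hX hY hZ.
rewrite (superbrE hX (superbr_gl_part hY hZ)).
rewrite (superbrE (superbr_gl_part hX hY) hZ).
rewrite (superbrE hY (superbr_gl_part hX hZ)).
rewrite (superbrE hX hY) (superbrE hX hZ) (superbrE hY hZ).
rewrite !(mulmxBl, mulmxBr) -!(scalemxAl, scalemxAr) !mulmxA.
move: (X *m Y *m Z) (X *m Z *m Y) (Y *m X *m Z) (Y *m Z *m X)
  (Z *m X *m Y) (Z *m Y *m X) => M1 M2 M3 M4 M5 M6.
apply/matrixP=> r c; rewrite !mxE.
by case: i {hX}; case: j {hY}; case: k {hZ}; rewrite /= ?expr1 ?expr0; ring.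
Qed.

Lemma superbr_periplectic i j X Y :
  X \in periplectic_part i -> Y \in periplectic_part j ->
  superbr X Y \in periplectic_part (i (+) j).
Proof.
move=> pX pY.
have gX : X \in gl_part i by move: pX; rewrite memv_cap => /andP[].
have gY : Y \in gl_part j by move: pY; rewrite memv_cap => /andP[].
rewrite memv_cap (superbr_gl_part gX gY) andbT (superbrE gX gY).
apply/mem_periplectic_space.
case: i pX {gX}; case: j pY {gY}.
- move=> /mem_periplectic_odd[B [C [BT CT ->]]].
  move=> /mem_periplectic_odd[B' [C' [BT' CT' ->]]].
  exists (B *m C' + B' *m C), 0, 0.
  rewrite !mulmx_block !(mul0mx, mulmx0, addr0, add0r) expr1 scaleN1r opprK.
  rewrite add_block_mx !addr0 !trmx0 oppr0; split => //.
    congr block_mx; first by rewrite addrC.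
    rewrite linearD /= !trmx_mul BT CT BT' CT' !mulNmx -opprD opprK.
    by [].
  have tr0 (S K : 'M[F]_n) : S^T = S -> K^T = - K -> \tr (S *m K) = 0.
    move=> ST KT; have : \tr (S *m K) = - \tr (S *m K).
      by rewrite -{1}mxtrace_tr trmx_mul ST KT mulNmx linearN /= mxtrace_mulC.
    by move=> /eqP; rewrite -addr_eq0 -mulr2n mulrn_eq0 /= => /eqP.
  by rewrite mxtraceD !tr0 // addr0.
- move=> /mem_periplectic_even[A trA ->].
  move=> /mem_periplectic_odd[B [C [BT CT ->]]].
  exists 0, (- (B *m A^T + A *m B)), (C *m A + A^T *m C).
  rewrite !mulmx_block !(mul0mx, mulmx0, addr0, add0r) expr0 scale1r.
  rewrite opp_block_mx add_block_mx trmx0 !(oppr0, addr0) mxtrace0; split => //.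
  + by congr block_mx; rewrite ?mulmxN ?mulNmx ?opprK // opprD.
  + by rewrite linearN linearD /= !trmx_mul BT trmxK addrC.
  + by rewrite linearD /= !trmx_mul CT trmxK mulmxN mulNmx -opprD addrC.
- move=> /mem_periplectic_odd[B [C [BT CT ->]]].
  move=> /mem_periplectic_even[A trA ->].
  exists 0, (A *m B + B *m A^T), (- (A^T *m C + C *m A)).
  rewrite !mulmx_block !(mul0mx, mulmx0, addr0, add0r) expr0 scale1r.
  rewrite opp_block_mx add_block_mx trmx0 !(oppr0, addr0) mxtrace0; split => //.
  + by congr block_mx; rewrite ?mulmxN ?mulNmx ?opprK // opprD.
  + by rewrite linearD /= !trmx_mul BT trmxK addrC.
  + rewrite linearN linearD /= !trmx_mul CT trmxK mulmxN mulNmx -opprD opprK.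
    by rewrite opprK addrC.
- move=> /mem_periplectic_even[A trA ->].
  move=> /mem_periplectic_even[A' trA' ->].
  exists (A' *m A - A *m A'), 0, 0.
  rewrite !mulmx_block !(mul0mx, mulmx0, addr0, add0r) expr0 scale1r.
  rewrite opp_block_mx add_block_mx !trmx0 !(oppr0, addr0); split => //.
    congr block_mx; rewrite ?oppr0 ?addr0 // linearB /= !trmx_mul.
    by rewrite !mulNmx !mulmxN !opprK opprB.
  by rewrite linearB /= mxtrace_mulC subrr.
Qed.

Lemma periplectic_direct :
  (periplectic_part false :&: periplectic_part true = 0)%VS.
Proof.
apply/eqP; rewrite -subv0; apply/subvP => X.
rewrite memv_cap memv0 => /andP[h0 h1].
have g0 : X \in gl_part false by move: h0; rewrite memv_cap => /andP[].
have : X \in gl_part true by move: h1; rewrite memv_cap => /andP[].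
by rewrite mem_gl_part (gl_proj0 g0) // eq_sym.
Qed.

Lemma periplectic_antisym i j X Y :
  X \in periplectic_part i -> Y \in periplectic_part j ->
  superbr X Y = - ((-1) ^+ (i && j) *: superbr Y X).
Proof.
rewrite !memv_cap => /andP[_ gX] /andP[_ gY]; exact: superbr_antisym.
Qed.

Lemma periplectic_jacobi i j k X Y Z :
  X \in periplectic_part i -> Y \in periplectic_part j ->
  Z \in periplectic_part k ->
  superbr X (superbr Y Z)
    = superbr (superbr X Y) Z + (-1) ^+ (i && j) *: superbr Y (superbr X Z).
Proof.
rewrite !memv_cap => /andP[_ gX] /andP[_ gY] /andP[_ gZ].
exact: (superbr_jacobi gX gY gZ).
Qed.

(* P(n-1), inside gl(n|n). *)
Definition periplectic : lieSuperalgebra F :=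
  LieSuperalgebra periplectic_direct superbr_linearl superbr_linearr
    superbr_periplectic periplectic_antisym periplectic_jacobi.

End Periplectic.

Definition is_partition (mu : seq nat) (n : nat) : bool :=
  [&& sorted geq mu, 0%N \notin mu & sumn mu == n].

Definition conj_part (mu : seq nat) (i : nat) : nat := count (leq i) mu.

(* reshape_index mu r is the index of the block that contains row r. *)
Definition jordan_mx (F : nzRingType) (n : nat) (mu : seq nat) : 'M[F]_n :=
  \matrix_(r, c) ((r == c.+1 :> nat)
                  && (reshape_index mu r == reshape_index mu c))%:R.

Lemma mxtrace_jordan (F : nzRingType) n mu : \tr (jordan_mx F n mu) = 0.
Proof.
by rewrite /mxtrace big1 // => i _; rewrite mxE ltn_eqF.
Qed.

(* The orbit of periplectic_even J under the adjoint group of g_0, SL_n acting *)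
(* by conjugation on the block A.                                              *)
Definition even_orbit (F : numFieldType) n (J : 'M[F]_n) : periplectic F n -> Prop :=
  fun y => exists2 h : 'M[F]_n,
    \det h = 1 & y = periplectic_even (h *m J *m invmx h).

Lemma even_orbit_neq0 (F : numFieldType) n (J : 'M[F]_n) :
  exists y, even_orbit J y.
Proof.
exists (periplectic_even J); exists 1%:M; first exact: det1.
by rewrite invmx1 mulmx1 mul1mx.
Qed.

(* The vanishing ideal of the orbit is prime: two points of the orbit lie on   *)
(* the image of a line through two invertible matrices, and along this line    *)
(* functions in S(g_0) are, up to powers of det, univariate polynomials.       *)
Section Irreducible.
Variables (C : numClosedFieldType) (n : nat) (J : 'M[C]_n).
Hypothesis trJ : \tr J = 0.

Lemma even_orbit_GL (h : 'M[C]_n) : h \in unitmx ->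
  even_orbit J (periplectic_even (h *m J *m invmx h)).
Proof.
rewrite unitmxE unitfE => dh; have [n0|n_gt0] := posnP n.
  by exists h => //; move: h {dh}; rewrite n0 => h; rewrite det_mx00.
pose c := n.-root (\det h)^-1.
have cn : c ^+ n = (\det h)^-1 by rewrite rootCK.
have c0 : c != 0.
  apply/eqP => c0; move: dh; rewrite -[\det h]invrK -cn c0 expr0n gtn_eqF //.
  by rewrite invr0 eqxx.
exists (c *: h); first by rewrite detZ cn mulVf.
congr periplectic_even; rewrite invmxZ; last first.
  by rewrite unitmxE detZ unitfE mulf_neq0 ?expf_neq0.
by rewrite -!scalemxAl -scalemxAr scalerA mulfV // scale1r.
Qed.

Lemma meval_ratio m (f : {mpoly C[m]}) (u : 'I_m -> {poly C}) (d : {poly C}) :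
  exists (p : {poly C}) (N : nat), forall t, d.[t] != 0 ->
    p.[t] = d.[t] ^+ N * f.@[fun i => (u i).[t] / d.[t]].
Proof.
elim/mpolyind: f => [|c e f _ _ [p [N IH]]].
  by exists 0, 0%N => t _; rewrite horner0 meval0 mulr0.
exists (c *: (\prod_i (u i) ^+ e i) * d ^+ N + d ^+ (mdeg e) * p).
exists (mdeg e + N)%N => t dt.
rewrite hornerD !hornerM !horner_exp hornerZ horner_prod IH // mevalD mevalZ.
rewrite mevalX mulrDr exprD mulrA; congr (_ + _).
transitivity (d.[t] ^+ N * c * (d.[t] ^+ mdeg e *
    \prod_(i < m) ((u i).[t] / d.[t]) ^+ e i)); last by ring.
rewrite mdegE -prodrXr -big_split /= mulrC -mulrA; congr (_ * (_ * _)).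
apply: eq_bigr => i _; rewrite horner_exp -exprMn mulrCA divff ?mulr1 //.
Qed.

Local Notation g0 := (periplectic_part C n false).
Variable B : invariant_form (periplectic C n).

Let coef k a b : C := \sum_j coord (vbasis g0) j (delta_mx a b)
  * B (vbasis g0)`_k (vbasis g0)`_j.

Lemma form_coef (k : 'I_(\dim g0)) (y : 'M[C]_(n + n)) : y \in g0 ->
  B (vbasis g0)`_k y = \sum_a \sum_b y a b * coef k a b.
Proof.
move=> yg0.
have eg0 i : (vbasis g0)`_i \in g0.
  case: (ltnP i (\dim g0)) => hi.
    by apply: (@vbasis_mem _ _ _ g0); rewrite mem_nth ?size_tuple.
  by rewrite nth_default ?size_tuple // mem0v.
have Bsum (s : seq 'I_(\dim g0)) (c : 'I_(\dim g0) -> C) :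
    B (vbasis g0)`_k (\sum_(j <- s) c j *: (vbasis g0)`_j)
    = \sum_(j <- s) c j * B (vbasis g0)`_k (vbasis g0)`_j.
  have B0 : B (vbasis g0)`_k 0 = 0.
    have := @form_linearr _ _ B 0 0 (vbasis g0)`_k (mem0v _) (mem0v _) (eg0 _) (-1).
    by rewrite scaler0 addr0 mulN1r addNr.
  elim: s => [|j s IH]; first by rewrite !big_nil.
  rewrite !big_cons -IH; apply: form_linearr => //.
  by apply: memv_suml => j' _; apply: memvZ.
rewrite {1}(coord_vbasis yg0) Bsum.
under [RHS]eq_bigr do under eq_bigr do rewrite /coef mulr_sumr.
under [RHS]eq_bigr do rewrite exchange_big.
rewrite exchange_big; apply: eq_bigr => j _ /=.
rewrite {1}(matrix_sum_delta y) linear_sum mulr_suml; apply: eq_bigr => a _.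
rewrite linear_sum mulr_suml; apply: eq_bigr => b _.
by rewrite linearZ mulrA.
Qed.

Lemma even_orbit_irr : prime_idealr_closed (vanishing B (even_orbit J)).
Proof.
move=> f1 f2 /asboolP f12; apply/orP.
case: (pselect (f1 \in vanishing B (even_orbit J))) => [|nf1]; first by left.
case: (pselect (f2 \in vanishing B (even_orbit J))) => [|nf2]; first by right.
exfalso.
have wit f : ~ f \in vanishing B (even_orbit J) ->
    exists2 h : 'M[C]_n, \det h = 1
      & sym_fun B f (periplectic_even (h *m J *m invmx h)) != 0.
  move=> nf; apply: contrapT => nh; apply: nf; apply/asboolP => y [h dh ->].
  by apply: contrapT => /eqP fy; apply: nh; exists h.
have [h1 dh1 fh1] := wit _ nf1; have [h2 dh2 fh2] := wit _ nf2.
pose hp : 'M[{poly C}]_n := map_mx polyC h1 + 'X *: map_mx polyC (h2 - h1).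
pose d := \det hp.
pose z := hp *m map_mx polyC J *m \adj hp.
pose zz := block_mx z 0 0 (- z^T).
pose u (k : 'I_(\dim g0)) : {poly C} :=
  \sum_a \sum_b zz a b * (coef k a b)%:P.
pose H t := h1 + t *: (h2 - h1).
have hpE t : map_mx (horner_eval t) hp = H t.
  by apply/matrixP => r c; rewrite !mxE /horner_eval hornerD hornerM hornerX !hornerC.
have dE t : d.[t] = \det (H t) by rewrite -hpE det_map_mx.
have zE t : d.[t] != 0 ->
    map_mx (horner_eval t) z = d.[t] *: (H t *m J *m invmx (H t)).
  move=> dt; have uH : H t \in unitmx by rewrite unitmxE -dE unitfE.
  rewrite /z !map_mxM map_mx_adj hpE /invmx uH -scalemxAr scalerA -dE mulfV //.
  rewrite scale1r; congr (_ *m _ *m _).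
  by apply/matrixP => r c; rewrite !mxE /= /horner_eval hornerC.
have uE f t : d.[t] != 0 -> sym_fun B f (periplectic_even (H t *m J *m invmx (H t)))
    = f.@[fun k => (u k).[t] / d.[t]].
  move=> dt; rewrite /sym_fun; apply: meval_eq => k.
  have yg0 : periplectic_even (H t *m J *m invmx (H t)) \in g0.
    apply/mem_periplectic_even; exists (H t *m J *m invmx (H t)) => //.
    by rewrite mxtrace_mulC mulmxA mulVmx ?mul1mx // unitmxE -dE unitfE.
  have zzE : map_mx (horner_eval t) zz
      = d.[t] *: periplectic_even (H t *m J *m invmx (H t)).
    rewrite /zz map_block_mx !map_mx0 map_mxN -matrix.map_trmx zE // scale_block_mx.
    by rewrite !scaler0 scalerN linearZ.
  rewrite (form_coef _ yg0) /u horner_sum mulr_suml; apply: eq_bigr => a _.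
  rewrite horner_sum mulr_suml; apply: eq_bigr => b _.
  rewrite hornerM hornerC -[(zz a b).[t]]/(horner_eval t (zz a b)).
  have -> : horner_eval t (zz a b) = (map_mx (horner_eval t) zz) a b by rewrite [RHS]mxE.
  by rewrite zzE [X in _ = X * _ / _]mxE [RHS]mulrC !mulrA mulVf ?mul1r.
have [p1 [N1 hp1]] := meval_ratio f1 u d.
have [p2 [N2 hp2]] := meval_ratio f2 u d.
have pd0 : p1 * p2 * d = 0.
  have pt t : (p1 * p2 * d).[t] = 0.
    rewrite !hornerM; have [->|dt] := eqVneq d.[t] 0; first by rewrite mulr0.
    have uH : H t \in unitmx by rewrite unitmxE -dE unitfE.
    have := f12 _ (even_orbit_GL uH); rewrite uE // mevalM => f0.
    by rewrite hp1 // hp2 // mulrACA f0 mulr0 mul0r.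
  apply/eqP; apply: contraT => pn0.
  have := @max_poly_roots _ _ [seq i%:R | i <- iota 0 (size (p1 * p2 * d))] pn0.
  rewrite size_map size_iota ltnn; apply; first by apply/allP => x _; apply/rootP.
  by rewrite map_inj_uniq ?iota_uniq // => i j /eqP; rewrite eqr_nat => /eqP.
have d0 : d.[0] != 0 by rewrite dE /H scale0r addr0 dh1 oner_eq0.
have d1 : d.[1] != 0 by rewrite dE /H scale1r addrC subrK dh2 oner_eq0.
move/eqP: pd0; rewrite !mulf_eq0 => /orP[/orP[]|] /eqP e0.
- move: (hp1 _ d0); rewrite e0 horner0 -uE // /H scale0r addr0.
  by move/esym/eqP; rewrite mulf_eq0 expf_eq0 (negPf d0) andbF (negPf fh1).
- move: (hp2 _ d1); rewrite e0 horner0 -uE // /H scale1r addrC subrK.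
  by move/esym/eqP; rewrite mulf_eq0 expf_eq0 (negPf d1) andbF (negPf fh2).
- by move: d0; rewrite e0 horner0 eqxx.
Qed.
End Irreducible.

Definition k_even_orbit (C : numClosedFieldType) n (J : 'M[C]_n)
    (trJ : \tr J = 0) (B : invariant_form (periplectic C n)) : nat :=
  k_orbit (even_orbit_neq0 J) (even_orbit_irr trJ (B := B)).

(* Main.v *)
(* The generic rank of M(g) on the orbit is its rank at any point y = h J h^-1.
   For n >= 3 every invariant form on sl(n) is c times the trace form, so M(g) at
   y is the Gram matrix of c tr((B C' + B' C) y) on pairs (B, C) of a symmetric
   and a skew matrix. Let P be the permutation matrix reversing each Jordan
   block, so P J P = J^T. Encoding (B, C), up to the action of h, by the single
   matrix X = (P B P + C) / 2 turns this form into 2 c tr(P X'^T P (X J - J^T X)),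
   hence the rank is that of X |-> X J - J^T X. Its kernel consists of Hankel
   blocks and has dimension sum_(k, l) min(mu_k, mu_l) = sum_i (mu'_i)^2. *)
From HB Require Import structures.
Require Import Defs.
From mathcomp Require Import all_boot all_order all_algebra fingroup perm.
From mathcomp Require Import reals complex.
From mathcomp Require Import boolp mpoly ring_quotient fraction zify ring.

Set Implicit Arguments.
Unset Strict Implicit.
Unset Printing Implicit Defensive.

Import GRing.Theory Num.Theory.
Local Open Scope ring_scope.
Local Open Scope quotient_scope.
Local Open Scope complex_scope.

(** * Counting positions in the blocks of a partition *)

Section Blocks.
Local Open Scope nat_scope.

Lemma reshape_index_consl m mu i : i < m -> reshape_index (m :: mu) i = 0.
Proof. by move=> im; rewrite /reshape_index /= subn_eq0 im. Qed.

Lemma reshape_index_consr m mu i :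
  reshape_index (m :: mu) (m + i) = (reshape_index mu i).+1.
Proof. by rewrite /reshape_index /= subn_eq0 ltnNge leq_addr /= -addnS addKn. Qed.

Lemma reshape_offset_consl m mu i : i < m -> reshape_offset (m :: mu) i = i.
Proof.
by move=> im; rewrite /reshape_offset reshape_index_consl //= subn0.
Qed.

Lemma reshape_offset_consr m mu i :
  reshape_offset (m :: mu) (m + i) = reshape_offset mu i.
Proof. by rewrite /reshape_offset reshape_index_consr /= subnDl. Qed.

Lemma sum_reshape mu (G : nat -> nat -> nat) :
  \sum_(i < sumn mu) G (reshape_index mu i) (reshape_offset mu i)
    = \sum_(k < size mu) \sum_(p < nth 0 mu k) G k p.
Proof.
elim: mu G => [|m mu IH] G; first by rewrite !big_ord0.
rewrite /= big_split_ord big_ord_recl /=; congr (_ + _).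
  by apply: eq_bigr => i _; rewrite reshape_index_consl ?reshape_offset_consl.
rewrite -(IH (fun k p => G k.+1 p)); apply: eq_bigr => i _.
by rewrite reshape_index_consr reshape_offset_consr.
Qed.

Lemma sum_lt_minn m k : \sum_(p < k) (p < m) = minn k m.
Proof.
elim: k => [|k IH]; first by rewrite big_ord0 min0n.
by rewrite big_ord_recr /= IH; lia.
Qed.

(** Double counting: [minn a c] is the number of [i] with [i < a] and [i < c], so both sides count
    pairs of parts together with such an [i]. The bound on the parts ensures that [n] values of [i]
    suffice. *)
Lemma sum_minn_conj_part mu n : all (geq n) mu ->
  \sum_(a <- mu) \sum_(c <- mu) minn a c
    = \sum_(1 <= i < n.+1) conj_part mu i ^ 2.
Proof.
move=> /allP le_n; rewrite big_add1 /= big_mkord.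
have cnt i : conj_part mu i = \sum_(a <- mu) (i <= a).
  rewrite /conj_part; elim: (mu) => [|a s IH] /=; first by rewrite big_nil.
  by rewrite big_cons IH.
under [RHS]eq_bigr do rewrite -mulnn cnt big_distrlr /=.
rewrite [RHS]exchange_big /=; apply: eq_big_seq => a amu.
rewrite [RHS]exchange_big /=; apply: eq_big_seq => c _.
transitivity (\sum_(i < n) (i < minn a c)); last first.
  by apply: eq_bigr => i _; rewrite mulnb leq_min.
by rewrite sum_lt_minn; move: (le_n _ amu) => /= ?; lia.
Qed.

(** Induction on the blocks. A new first block of size [m] adds one start, of weight [m + sumn mu].
    As [m] is the largest part, minima with [m] add [m + 2 * sumn mu] to the double sum, and the
    last term grows by [m]. *)
Lemma sum_block_starts mu : sorted geq mu -> 0 \notin mu ->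
  2 * \sum_(i < sumn mu) (sumn mu - i) * (reshape_offset mu i == 0)
    = \sum_(a <- mu) \sum_(c <- mu) minn a c + sumn mu.
Proof.
elim: mu => [|m mu IH]; first by rewrite !big_nil big_ord0.
move=> /= mu_path; rewrite inE negb_or eq_sym => /andP[m0 mu0].
have {IH} := IH (path_sorted mu_path) mu0.
have le_m : forall a, a \in mu -> a <= m.
  have gtr : transitive geq by move=> a b c /= h1 h2; apply: leq_trans h2 h1.
  by move/(order_path_min gtr)/allP: mu_path.
rewrite big_split_ord /=.
under [X in _ -> 2 * (_ + X) = _]eq_bigr do
  rewrite reshape_offset_consr subnDl.
set S := \sum_(i < sumn mu) _; set T := \sum_(a <- mu) _ => ST.
have -> : \sum_(i < m) (m + sumn mu - i) * (reshape_offset (m :: mu) i == 0)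
    = m + sumn mu.
  case: m m0 {mu_path le_m} => // m _.
  rewrite big_ord_recl reshape_offset_consl //= subn0 muln1 big1 ?addn0 //.
  move=> i _; rewrite (reshape_offset_consl _ (ltn_ord (lift ord0 i))).
  by rewrite muln0.
have sumE : \sum_(c <- mu) minn m c = sumn mu.
  rewrite sumnE; apply: eq_big_seq => a /le_m; lia.
have -> : \sum_(a <- m :: mu) \sum_(c <- m :: mu) minn a c = m + 2 * sumn mu + T.
  rewrite big_cons big_cons minnn sumE.
  under eq_bigr do rewrite big_cons minnC.
  by rewrite big_split /= sumE -/T; lia.
by lia.
Qed.

(** Each row from 1 on either starts a block or continues one, so the weights of both kinds total
    [1 + ... + (n - 1)], and [sum_block_starts] gives the weight of the starts. Row 0 is a start of
    weight [n] outside the range. *)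
Lemma sum_in_block mu n (b : nat -> bool) :
    sorted geq mu -> 0 \notin mu -> sumn mu = n -> 0 < n ->
    (forall i, 0 < i < n -> b i = (reshape_offset mu i != 0)) ->
  2 * \sum_(1 <= i < n) (n - i) * b i
    + \sum_(a <- mu) \sum_(c <- mu) minn a c = n ^ 2.
Proof.
move=> mu_s mu0 <- + hb; have := sum_block_starts mu_s mu0.
set n' := sumn mu in hb *; set T := \sum_(a <- mu) _ => ST n0.
have {ST} : 2 * (n' + \sum_(1 <= i < n') (n' - i) * (reshape_offset mu i == 0))
    = T + n'.
  rewrite -ST -(big_mkord predT (fun i => (n' - i) * (reshape_offset mu i == 0))).
  by rewrite [in RHS]big_ltn //= muln1 subn0.
have : \sum_(1 <= i < n') (n' - i) * b i
    + \sum_(1 <= i < n') (n' - i) * (reshape_offset mu i == 0)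
    = \sum_(1 <= i < n') (n' - i).
  rewrite -big_split /=; apply: eq_big_nat => i hi.
  by rewrite hb //; case: eqP => _; rewrite /= ?muln1 ?muln0 ?addn0 ?add0n.
have : 2 * \sum_(1 <= i < n') (n' - i) + n' = n' ^ 2.
  rewrite big_nat_rev /=.
  have -> : \sum_(1 <= i < n') (n' - (1 + n' - i.+1)) = \sum_(1 <= i < n') i.
    by apply: eq_big_nat => i /andP[]; lia.
  have -> : \sum_(1 <= i < n') i = \sum_(0 <= i < n') i.
    by rewrite [RHS]big_ltn // add0n.
  by elim: (n') => [|k IH]; [rewrite big_geq | rewrite big_nat_recr //= mulnDr; lia].
by lia.
Qed.

End Blocks.

(** * Matrices intertwining a Jordan matrix with its transpose *)

Section Jordan.
Variables (F : fieldType) (n : nat) (mu : seq nat).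
Hypothesis mu_sum : sumn mu = n.+1.
Local Notation J := (jordan_mx F n.+1 mu).
Local Notation blk := (reshape_index mu).
Local Notation pos := (reshape_offset mu).
Local Notation bsize k := (nth 0%N mu k).
Local Notation cell k p := (inord (flatten_index mu k p) : 'I_n.+1).

Lemma pos_lt (c : 'I_n.+1) : (pos c < bsize (blk c))%N.
Proof. by apply: reshape_offsetP; rewrite mu_sum. Qed.

Lemma cell_val k p : (p < bsize k)%N -> cell k p = flatten_index mu k p :> nat.
Proof. by move=> pk; rewrite inordK // -mu_sum flatten_indexP. Qed.

Lemma blk_cell k p : (p < bsize k)%N -> blk (cell k p) = k.
Proof. by move=> pk; rewrite cell_val // flatten_indexKl. Qed.

Lemma pos_cell k p : (p < bsize k)%N -> pos (cell k p) = p.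
Proof. by move=> pk; rewrite cell_val // flatten_indexKr. Qed.

Lemma cell_blk_pos (c : 'I_n.+1) k p : blk c = k -> pos c = p -> cell k p = c.
Proof. by move=> <- <-; apply: ord_inj; rewrite cell_val ?pos_lt ?reshape_indexK. Qed.

Lemma jordan_mxE r c :
  J r c = ((blk r == blk c) && (pos r == (pos c).+1))%:R.
Proof.
rewrite mxE andbC; congr (_%:R); congr (nat_of_bool _).
have [bb|//] := eqVneq (blk r) (blk c).
have := reshape_indexK mu r; have := reshape_indexK mu c.
by rewrite /flatten_index /= bb; lia.
Qed.

(** A column of [J] has at most one nonzero entry, so right multiplication by [J] shifts the columns
    of each block to the left and clears the last one. *)
Lemma mulmx_jordan m (X : 'M[F]_(m, n.+1)) r c :
  (X *m J) r c =
    if ((pos c).+1 < bsize (blk c))%N then X r (cell (blk c) (pos c).+1) else 0.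
Proof.
rewrite mxE; case: ifPn => [pc|pc].
  rewrite (bigD1 (cell (blk c) (pos c).+1)) //= jordan_mxE blk_cell // pos_cell //.
  rewrite !eqxx mulr1 big1 ?addr0 // => k kc; rewrite jordan_mxE.
  case: eqP => [bk|]; last by rewrite mulr0.
  case: eqP => [pk|]; last by rewrite mulr0.
  by rewrite -(cell_blk_pos bk pk) eqxx in kc.
rewrite big1 // => k _; rewrite jordan_mxE.
case: eqP => [bk|]; last by rewrite mulr0.
case: eqP => [pk|]; last by rewrite mulr0.
by rewrite -pk -bk pos_lt in pc.
Qed.

Lemma mul_trmx_jordan m (X : 'M[F]_(n.+1, m)) r c :
  (J^T *m X) r c =
    if ((pos r).+1 < bsize (blk r))%N then X (cell (blk r) (pos r).+1) c else 0.
Proof.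
have -> : (J^T *m X) r c = (X^T *m J) c r.
  by rewrite -{1}[X]trmxK -trmx_mul mxE.
by rewrite mulmx_jordan mxE.
Qed.

(* A solution of X J = J^T X is a block matrix with Hankel blocks, supported
   on pos r + pos c < min of the two block sizes; the coordinates below pick
   each Hankel parameter once. *)
Definition hankel_coords : {set 'I_n.+1 * 'I_n.+1} :=
  [set rc : 'I_n.+1 * 'I_n.+1 | (pos rc.1 == 0%N) && (pos rc.2 < bsize (blk rc.1))%N].

(** Entrywise, the relation says that [X] is constant along the antidiagonals of each block, with
    value 0 where a single shift leaves the block. *)
Lemma intertwiner_eq0 (X : 'M[F]_n.+1) : X *m J = J^T *m X ->
  (forall rc, rc \in hankel_coords -> X rc.1 rc.2 = 0) -> X = 0.
Proof.
move=> XJ X0.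
have step r c := congr1 (fun Y : 'M_n.+1 => Y r c) XJ.
(* Following the antidiagonal down and to the left reaches the last row of the block before the
   columns run out; there the relation gives 0. *)
have high m : forall r c : 'I_n.+1, (bsize (blk r) - pos r <= m)%N ->
    (bsize (blk r) <= pos r + pos c)%N -> X r c = 0.
  elim: m => [|m IH] r c.
    by rewrite leqNgt subn_gt0 pos_lt.
  move=> hm hs; have pr := pos_lt r; have pc := pos_lt c.
  have c0 : (0 < pos c)%N by move: hs pr; lia.
  have pc' : ((pos c).-1 < bsize (blk c))%N by move: c0 pc; lia.
  have := step r (cell (blk c) (pos c).-1).
  rewrite mulmx_jordan mul_trmx_jordan blk_cell // pos_cell // prednK // pc.
  rewrite (cell_blk_pos (erefl (blk c)) (erefl (pos c))) => ->; case: ifPn => // pr'.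
  by apply: IH; rewrite blk_cell ?pos_cell //; move: hm hs c0; lia.
(* The remaining antidiagonals are followed up and to the right: they either leave the block on the
   right, giving 0, or reach a row of position 0, at an entry of [hankel_coords]. *)
have low m : forall r c : 'I_n.+1, (pos r <= m)%N -> X r c = 0.
  elim: m => [|m IH] r c hm; (have [hs|hs] := leqP (bsize (blk r)) (pos r + pos c);
    first exact: high (leqnn _) hs).
    by apply: (X0 (r, c)); rewrite inE /=; move: hm hs; lia.
  have [r0|r0] := posnP (pos r); first by apply: IH; rewrite r0.
  have pr := pos_lt r.
  have pr' : ((pos r).-1 < bsize (blk r))%N by move: pr; lia.
  have := step (cell (blk r) (pos r).-1) c.
  rewrite mulmx_jordan mul_trmx_jordan blk_cell // pos_cell // prednK // pr.
  rewrite (cell_blk_pos (erefl (blk r)) (erefl (pos r))) => <-; case: ifPn => // _.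
  by apply: IH; rewrite pos_cell //; move: hm; lia.
by apply/matrixP => r c; rewrite mxE (low (pos r)).
Qed.

Lemma intertwiner_ex (f : 'I_n.+1 * 'I_n.+1 -> F) :
  exists2 X : 'M[F]_n.+1, X *m J = J^T *m X
    & forall rc, rc \in hankel_coords -> X rc.1 rc.2 = f rc.
Proof.
(* [g k l d] is the value on antidiagonal [d] of block [(k, l)]. Cutting off at the smaller size
   makes it 0 whenever just one of the two shifts leaves the block. *)
pose g k l d := if (d < minn (bsize k) (bsize l))%N
  then f (cell k 0, cell l d) else 0.
exists (\matrix_(r, c) g (blk r) (blk c) (pos r + pos c)%N).
  apply/matrixP => r c; rewrite mulmx_jordan mul_trmx_jordan !mxE.
  have pr := pos_lt r; have pc := pos_lt c.
  have big k l d : (minn (bsize k) (bsize l) <= d)%N -> g k l d = 0.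
    by rewrite /g leqNgt => /negPf ->.
  case: ifPn => hc; case: ifPn => hr; rewrite ?blk_cell ?pos_cell ?addnS ?addSn //.
    by rewrite big //; move: hr pr; lia.
  by rewrite big //; move: hc pc; lia.
move=> [r c]; rewrite inE mxE /= => /andP[/eqP r0 hc].
rewrite /g r0 add0n leq_min hc pos_lt (cell_blk_pos (erefl _) r0).
by rewrite (cell_blk_pos (erefl (blk c)) (erefl (pos c))).
Qed.

Definition intertwining_mx : 'M[F]_(n.+1 * n.+1) :=
  lin_mulmxr J - lin_mulmx J^T.

Lemma mul_intertwining_mx (X : 'M[F]_n.+1) :
  mxvec X *m intertwining_mx = mxvec (X *m J - J^T *m X).
Proof. by rewrite mulmxBr !mul_vec_lin linearB. Qed.

(** Reading off the entries at [hankel_coords], which is multiplication by [D], maps the kernel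
    isomorphically onto the full row space: injectively by [intertwiner_eq0], surjectively by
    [intertwiner_ex]. Rank-nullity then applies. *)
Lemma rank_intertwining_mx :
  (\rank intertwining_mx + #|hankel_coords| = n.+1 ^ 2)%N.
Proof.
pose g (i : 'I_#|hankel_coords|) := let rc := enum_val i in mxvec_index rc.1 rc.2.
pose D : 'M[F]_(n.+1 * n.+1, #|hankel_coords|) := colsub g 1%:M.
have vD (X : 'M[F]_n.+1) i :
    (mxvec X *m D) 0 i = X (enum_val i).1 (enum_val i).2.
  by rewrite mulmx_colsub mulmx1 mxE mxvecE.
have kerP (X : 'M[F]_n.+1) :
    reflect (X *m J = J^T *m X) (mxvec X <= kermx intertwining_mx)%MS.
  apply: (iffP sub_kermxP); rewrite mul_intertwining_mx.
    by move/(canRL mxvecK); rewrite linear0 => /eqP; rewrite subr_eq0 => /eqP.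
  by move=> ->; rewrite subrr linear0.
have rD : \rank (kermx intertwining_mx *m D) = \rank (kermx intertwining_mx).
  rewrite -[RHS](mxrank_mul_ker _ D) [X in (_ + \rank X)%N](_ : _ = 0) ?mxrank0 ?addn0 //.
  apply/eqP/rowV0P => v; rewrite sub_capmx -[v]vec_mxK => /andP[/kerP XJ /sub_kermxP XD].
  rewrite (intertwiner_eq0 XJ) ?linear0 // => rc rcH.
  by rewrite -(enum_rankK_in rcH rcH) -vD XD mxE.
have fullD : row_full (kermx intertwining_mx *m D).
  rewrite -sub1mx; apply/row_subP => i.
  have [X XJ Xf] := intertwiner_ex (fun rc => (rc == enum_val i)%:R).
  have -> : row i 1%:M = mxvec X *m D.
    apply/rowP => j; rewrite vD Xf ?enum_valP // !mxE (inj_eq enum_val_inj).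
    by rewrite eq_sym.
  by apply: submxMr; apply/kerP.
move: fullD; rewrite /row_full rD mxrank_ker => /eqP <-.
by rewrite subnKC ?rank_leq_row.
Qed.

(** A block of size [a] has one row of position 0 (none if [a = 0]); against a block of size [c] it
    admits the [minn a c] column positions below [a]. *)
Lemma card_hankel_coords :
  #|hankel_coords| = (\sum_(a <- mu) \sum_(c <- mu) minn a c)%N.
Proof.
have sumE (f : nat -> nat) : (\sum_(a <- mu) f a = \sum_(k < size mu) f (bsize k))%N.
  by rewrite (big_nth 0%N) big_mkord.
have sumB G : (\sum_(c < n.+1) G (blk c) (pos c)
    = \sum_(k < size mu) \sum_(p < bsize k) G k p)%N.
  by rewrite -mu_sum sum_reshape.
have -> : #|hankel_coords|
    = (\sum_(r < n.+1) \sum_(c < n.+1) (pos r == 0) * (pos c < bsize (blk r)))%N.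
  rewrite pair_big -sum1_card big_mkcond /=; apply: eq_bigr => -[r c] _.
  by rewrite inE /= mulnb; case: ifP.
transitivity (\sum_(r < n.+1) (pos r == 0) * \sum_(c <- mu) minn (bsize (blk r)) c)%N.
  apply: eq_bigr => r _; rewrite -big_distrr /=; congr (_ * _)%N.
  rewrite (sumB (fun k p => (p < bsize (blk r))%N : nat)) sumE.
  by apply: eq_bigr => k _; rewrite sum_lt_minn minnC.
rewrite (sumB (fun k p => (p == 0) * \sum_(c <- mu) minn (bsize k) c)%N).
rewrite sumE; apply: eq_bigr => k _; rewrite -big_distrl /=.
case: (bsize k) => [|m].
  by rewrite big_ord0 mul0n big1 // => c _; rewrite min0n.
by rewrite big_ord_recl big1 // addn0 mul1n.
Qed.

(* P reverses every Jordan block. *)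
Lemma jordan_reversal : exists P : 'M[F]_n.+1,
  [/\ P^T = P, P *m P = 1%:M & P *m J = J^T *m P].
Proof.
pose s (c : 'I_n.+1) := cell (blk c) (bsize (blk c) - (pos c).+1).
have s_lt (c : 'I_n.+1) : (bsize (blk c) - (pos c).+1 < bsize (blk c))%N.
  by have := pos_lt c; lia.
have blks c : blk (s c) = blk c by rewrite blk_cell.
have poss c : pos (s c) = (bsize (blk c) - (pos c).+1)%N by rewrite pos_cell.
have sK : involutive s.
  move=> c; apply: cell_blk_pos; first by rewrite blks.
  by rewrite poss blks; have := pos_lt c; lia.
pose p := perm (inv_inj sK).
have pp : (p * p = 1)%g by apply/permP => c; rewrite permM !permE.
have pV : (p^-1 = p)%g by apply/eqP; rewrite eq_invg_mul pp.
exists (perm_mx p); split; first by rewrite tr_perm_mx pV.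
  by rewrite -perm_mxM pp perm_mx1.
rewrite -row_permE -{2}pV -col_permE; apply/matrixP => r c.
rewrite [in LHS]mxE 2![in RHS]mxE !jordan_mxE !permE !blks !poss eq_sym.
case: eqP => //= bb; congr (_%:R); congr nat_of_bool.
by have := pos_lt r; have := pos_lt c; rewrite bb; lia.
Qed.

End Jordan.

(** * Invariant bilinear forms on n x n matrices *)

Section InvariantBilinear.
Variables (F : numFieldType) (n : nat).
Hypothesis n_gt2 : (2 < n)%N.
Variable f : 'M[F]_n -> 'M[F]_n -> F.
Hypothesis f_linl : forall a x x' y, f (a *: x + x') y = a * f x y + f x' y.
Hypothesis f_linr : forall a x y y', f x (a *: y + y') = a * f x y + f x y'.
Hypothesis f_inv :
  forall x y z, f (x *m y - y *m x) z = f x (y *m z - z *m y).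
Local Notation E := (@delta_mx F n n).

Let f0l y : f 0 y = 0.
Proof. by have := f_linl (-1) 0 0 y; rewrite scaler0 addr0 mulN1r addNr. Qed.

Let f0r x : f x 0 = 0.
Proof. by have := f_linr (-1) x 0 0; rewrite scaler0 addr0 mulN1r addNr. Qed.

Let fZl a x y : f (a *: x) y = a * f x y.
Proof. by rewrite -[a *: x]addr0 f_linl f0l addr0. Qed.

Let fZr a x y : f x (a *: y) = a * f x y.
Proof. by rewrite -[a *: y]addr0 f_linr f0r addr0. Qed.

Let fDl x x' y : f (x + x') y = f x y + f x' y.
Proof. by rewrite -[x]scale1r f_linl mul1r scale1r. Qed.

Let fDr x y y' : f x (y + y') = f x y + f x y'.
Proof. by rewrite -[y]scale1r f_linr mul1r scale1r. Qed.

Let fNl x y : f (- x) y = - f x y.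
Proof. by rewrite -scaleN1r fZl mulN1r. Qed.

Let fNr x y : f x (- y) = - f x y.
Proof. by rewrite -scaleN1r fZr mulN1r. Qed.

Let f_suml (I : finType) (x : I -> 'M[F]_n) y :
  f (\sum_i x i) y = \sum_i f (x i) y.
Proof. by apply: (big_morph (f^~ y)) => [u v|]; rewrite ?fDl ?f0l. Qed.

Let f_sumr (I : finType) x (y : I -> 'M[F]_n) :
  f x (\sum_i y i) = \sum_i f x (y i).
Proof. by apply: (big_morph (f x)) => [u v|]; rewrite ?fDr ?f0r. Qed.

Let comm_diag a k l :
  E a a *m E k l - E k l *m E a a = ((a == k)%:R - (a == l)%:R) *: E k l.
Proof.
rewrite !mul_delta_mx_cond scalerBl !scaler_nat (eq_sym l).
by case: (eqVneq a k) => [->|_]; case: eqVneq => [->|_].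
Qed.

(** Invariance under the diagonal unit [E a a], for which matrix units are weight vectors. *)
Let f_weight a i j k l :
  ((a == k)%:R - (a == l)%:R + ((a == i)%:R - (a == j)%:R)) * f (E i j) (E k l) = 0.
Proof.
have := f_inv (E i j) (E a a) (E k l).
rewrite comm_diag fZr -opprB comm_diag fNl fZl => /eqP.
by rewrite eq_sym -subr_eq0 opprK -mulrDl => /eqP.
Qed.

(** Only [E j i] has weight opposite to that of [E i j]. Otherwise [f_weight] has a nonzero factor:
    at [a = j] when [l = i], where it is -1, and else at [a = i], where it is 1 or 2. *)
Let f_off i j k l : i != j -> (k != j) || (l != i) -> f (E i j) (E k l) = 0.
Proof.
move=> ij kl.
have wP a : (a == k)%:R - (a == l)%:R + ((a == i)%:R - (a == j)%:R) != 0 :> F ->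
    f (E i j) (E k l) = 0.
  by move=> /negPf w0; have /eqP := f_weight a i j k l; rewrite mulf_eq0 w0 => /eqP.
have n0 m : m.+1%:R != 0 :> F by rewrite pnatr_eq0.
have n2 : 1 + 1 != 0 :> F := n0 1%N.
have [li|li] := eqVneq l i.
  apply: (wP j); rewrite li eqxx (eq_sym j i) (negPf ij).
  move: kl; rewrite li eqxx orbF eq_sym => /negPf ->.
  by rewrite subrr add0r sub0r oppr_eq0 oner_eq0.
apply: (wP i); rewrite eqxx (negPf ij) (eq_sym i l) (negPf li) !subr0.
by case: (i == k); rewrite ?add0r ?oner_neq0.
Qed.

Let comm_delta i j k : i != k ->
  E i j *m E j k - E j k *m E i j = E i k.
Proof. by move=> ik; rewrite !mul_delta_mx_cond eqxx eq_sym (negPf ik) subr0. Qed.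

(** Invariance on the cycle [E i j], [E j k], [E k i] compares dual pairs sharing a row; [f_dual_l]
    treats a shared column. *)
Let f_dual_r i j k : i != j -> j != k -> i != k ->
  f (E i k) (E k i) = f (E i j) (E j i).
Proof.
move=> ij jk ik; have := f_inv (E i j) (E j k) (E k i).
by rewrite comm_delta // comm_delta // eq_sym.
Qed.

Let f_dual_l i j k : i != j -> j != k -> i != k ->
  f (E i k) (E k i) = f (E j k) (E k j).
Proof.
move=> ij jk ik; have := f_inv (E j k) (E i j) (E k i).
rewrite -opprB comm_delta // -[X in _ = f _ X]opprB comm_delta 1?eq_sym //.
by rewrite fNl fNr => /oppr_inj.
Qed.

(** All dual pairs of off-diagonal units take one value [c]. Differences of diagonal units are
    brackets of such pairs, so the diagonal deviates from the trace form only by a common term,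
    which [\tr x = 0] removes. *)
Lemma invariant_bilinear_trace :
  exists c, forall x y, \tr x = 0 -> f x y = c * \tr (x *m y).
Proof.
pose o0 : 'I_n := Ordinal (ltn_trans (isT : 0 < 2)%N n_gt2).
pose o1 : 'I_n := Ordinal (ltn_trans (isT : 1 < 2)%N n_gt2).
pose o2 : 'I_n := Ordinal n_gt2.
pose c := f (E o0 o1) (E o1 o0).
have dual_r i j k : i != j -> i != k -> f (E i k) (E k i) = f (E i j) (E j i).
  by move=> ij ik; have [->//|jk] := eqVneq j k; apply: f_dual_r.
have dual_l i j k : i != k -> j != k -> f (E i k) (E k i) = f (E j k) (E k j).
  by move=> ik jk; have [->//|ij] := eqVneq i j; apply: f_dual_l.
have dualE i j : i != j -> f (E i j) (E j i) = c.
  move=> ij; wlog i1 : i ij / i != o1.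
    move=> H; have [i1|] := eqVneq i o1; last exact: H.
    (* The detour around row [o1] needs a third index, hence [2 < n]. *)
    have [k kj k1] : exists2 k, k != j & k != o1.
      by have [j0|j0] := eqVneq j o0; [exists o2; rewrite ?j0 | exists o0; rewrite // eq_sym].
    by rewrite (@dual_l i k) // H.
  by rewrite (@dual_r i o1) // (@dual_l i o0).
have fE i j y : i != j -> f (E i j) y = c * y j i.
  move=> ij; rewrite {1}(matrix_sum_delta y) f_sumr (bigD1 j) //= [X in _ + X]big1.
    rewrite addr0 f_sumr (bigD1 i) //= [X in _ + X]big1 ?addr0.
      by rewrite fZr dualE // mulrC.
    by move=> l li; rewrite fZr f_off ?mulr0 // li orbT.
  move=> k kj; rewrite f_sumr big1 // => l _; rewrite fZr f_off ?mulr0 // kj //.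
have fdiag i j y : f (E i i) y - f (E j j) y = c * (y i i - y j j).
  have [->|ij] := eqVneq i j; first by rewrite !subrr mulr0.
  have := f_inv (E i j) (E j i) y.
  rewrite !mul_delta_mx_cond !eqxx fDl fNl => ->; rewrite fE // !mxE.
  congr (_ * (_ - _)).
    rewrite (bigD1 i) //= mxE !eqxx mul1r big1 ?addr0 // => k ki.
    by rewrite mxE (negPf ki) andbF mul0r.
  rewrite (bigD1 j) //= mxE !eqxx mulr1 big1 ?addr0 // => k kj.
  by rewrite mxE (negPf kj) mulr0.
exists c => x y trx.
(* By [fdiag] this deviation is the same for every diagonal unit, so it enters the sum multiplied by
   [\tr x]. *)
pose d := f (E o0 o0) y - c * y o0 o0.
have fdE i : f (E i i) y = c * y i i + d.
  by have := fdiag i o0 y; rewrite /d => /eqP; rewrite subr_eq => /eqP ->; ring.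
transitivity (\sum_i (\sum_j (c * (x i j * y j i)) + d * x i i)).
  rewrite {1}(matrix_sum_delta x) f_suml; apply: eq_bigr => i _.
  rewrite f_suml (bigD1 i) //= [in RHS](bigD1 i) //= fZl fdE.
  rewrite [RHS]addrAC; congr (_ + _); first by ring.
  by apply: eq_bigr => j ji; rewrite fZl fE 1?eq_sym // mulrCA.
rewrite big_split /= -big_distrr /= -/(\tr x) trx mulr0 addr0.
rewrite /mxtrace big_distrr /=; apply: eq_bigr => i _.
by rewrite mxE big_distrr.
Qed.

End InvariantBilinear.

(** * Ranks, minors and specialization at points *)

Section Minors.
Variable F : fieldType.

Lemma mxrank_mxsub m n m' n' (f : 'I_m' -> 'I_m) (g : 'I_n' -> 'I_n)
    (A : 'M[F]_(m, n)) : (\rank (mxsub f g A) <= \rank A)%N.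
Proof.
rewrite mxsubrc (leq_trans (mxrankS (rowsub_sub _ _))) //.
rewrite -mxrank_tr -[in leqRHS]mxrank_tr.
have -> : (colsub g A)^T = rowsub g A^T by apply/matrixP => i j; rewrite !mxE.
exact: mxrankS (rowsub_sub _ _).
Qed.

Lemma maximal_minor m n (A : 'M[F]_(m, n)) :
  exists (f : 'I_(\rank A) -> 'I_m) (g : 'I_(\rank A) -> 'I_n),
    mxsub f g A \in unitmx.
Proof.
have fullA : row_full (rowsub (maxrankfun A) A)^T.
  by rewrite /row_full mxrank_tr; apply: maxrowsub_free.
exists (maxrankfun A), (fullrankfun fullA).
rewrite -unitmx_tr; have := fullrowsub_unit fullA; congr (_ \in unitmx).
by apply/matrixP => i j; rewrite !mxE.
Qed.

End Minors.

(* Ranks are detected by minors, and a minor vanishes under [phi] exactly when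
   it vanishes at every point. *)
Lemma mxrank_map_points (S : comNzRingType) (K F : fieldType) (I : Type)
    (D : I -> Prop) (phi : {rmorphism S -> K}) (ev : I -> {rmorphism S -> F})
    m n (A : 'M[S]_(m, n)) (r : nat) :
    (forall s, phi s = 0 <-> forall i, D i -> ev i s = 0) ->
    (exists i, D i) -> (forall i, D i -> \rank (map_mx (ev i) A) = r) ->
  \rank (map_mx phi A) = r.
Proof.
move=> phi0 [i0 Di0] rA; apply/eqP; rewrite eqn_leq; apply/andP; split.
  have [f [g]] := maximal_minor (map_mx phi A).
  rewrite unitmxE unitfE -map_mxsub det_map_mx => /eqP dphi.
  apply: contrapT => rlt; apply: dphi; apply/phi0 => i Di; apply: contrapT => /eqP di.
  apply: rlt; rewrite -(rA _ Di); apply: leq_trans (mxrank_mxsub f g _).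
  by rewrite -map_mxsub mxrank_unit // unitmxE unitfE det_map_mx.
rewrite -(rA _ Di0).
have [f [g]] := maximal_minor (map_mx (ev i0) A).
rewrite unitmxE unitfE -map_mxsub det_map_mx => /eqP dev.
apply: leq_trans (mxrank_mxsub f g _).
rewrite -map_mxsub mxrank_unit // unitmxE unitfE det_map_mx.
by apply/eqP => /phi0/(_ _ Di0).
Qed.

(** * From the vanishing ideal of an orbit to ranks at its points *)

Section KOrbit.
Variables (F : fieldType) (g : lieSuperalgebra F).
Local Notation g0 := (lsa_part g false).
Local Notation symalg := {mpoly F[\dim g0]}.

Lemma mod_frac_is_zmod_morphism (q : prime_idealr symalg) :
  zmod_morphism (mod_frac q).
Proof. by move=> x y; rewrite /mod_frac !rmorphB. Qed.

Lemma mod_frac_is_monoid_morphism (q : prime_idealr symalg) :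
  monoid_morphism (mod_frac q).
Proof. by split=> [|x y]; rewrite /mod_frac ?rmorph1 ?rmorphM. Qed.

HB.instance Definition _ q :=
  GRing.isZmodMorphism.Build symalg _ (mod_frac q) (mod_frac_is_zmod_morphism q).
HB.instance Definition _ q :=
  GRing.isMonoidMorphism.Build symalg _ (mod_frac q) (mod_frac_is_monoid_morphism q).

Lemma mod_frac_eq0 (q : prime_idealr symalg) x : (mod_frac q x == 0) = (x \in q).
Proof.
rewrite /mod_frac tofrac_eq0 -[x in RHS]subr0 Quotient.idealrBE.
by rewrite -(rmorph0 (\pi_({ideal_quot q})))%qT.
Qed.

Lemma sym_fun_sym_of (B : invariant_form g) x y : x \in g0 -> y \in g0 ->
  sym_fun B (sym_of x) y = B x y.
Proof.
move=> xg0 yg0; rewrite /sym_fun /sym_of raddf_sum /=.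
have eg0 (i : 'I_(\dim g0)) : (vbasis g0)`_i \in g0.
  by apply: (@vbasis_mem _ _ _ g0); rewrite mem_nth ?size_tuple.
have B0 : B 0 y = 0.
  have := @form_linearl _ _ B 0 0 y (mem0v _) (mem0v _) yg0 (-1).
  by rewrite scaler0 addr0 mulN1r addNr.
rewrite [in RHS](coord_vbasis xg0).
transitivity (\sum_i coord (vbasis g0) i x * B (vbasis g0)`_i y).
  by apply: eq_bigr => i _; rewrite mevalZ mevalXU.
elim: (index_enum _) => [|i s IH]; first by rewrite !big_nil B0.
rewrite !big_cons IH -form_linearl //.
by apply: memv_suml => j _; apply: memvZ.
Qed.

(** A function dies in the fraction field exactly when it lies in the vanishing ideal, that is, when
    it vanishes at every point of [O]; so [mxrank_map_points] applies. *)
Lemma k_orbit_rank (B : invariant_form g) (O : g -> Prop) O_neq0 O_irr r :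
    (forall y, O y -> \rank (map_mx (fun f => sym_fun B f y) (bracket_mx g)) = r) ->
  @k_orbit _ _ B O O_neq0 O_irr = r.
Proof.
move=> rO; rewrite /k_orbit /k_ideal.
apply: (@mxrank_map_points _ _ _ _ O (mod_frac _)
  (fun y => meval (fun i => B (vbasis g0)`_i y))) => // s.
split=> [/eqP|sO]; first by rewrite mod_frac_eq0 => /asboolP.
by apply/eqP; rewrite mod_frac_eq0; apply/asboolP.
Qed.

End KOrbit.

Section Generators.
Variables (F : fieldType) (V : vectType F) (U : {vspace V}) (k : nat).

(** Images of a basis span the image of [U]. This lets a Gram matrix over a basis of the odd part be
    compared with a map on all square matrices. *)
Lemma row_full_vbasis_image (phi : V -> 'rV[F]_k) : linear phi ->
    (forall z, exists2 v, v \in U & phi v = z) ->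
  row_full (\matrix_(i < \dim U) phi (vbasis U)`_i).
Proof.
move=> phi_lin phi_onto; rewrite -sub1mx; apply/row_subP => j.
have [v vU <-] := phi_onto (row j 1%:M).
have phi0 : phi 0 = 0.
  by have := phi_lin (-1) 0 0; rewrite scaler0 addr0 scaleN1r addNr.
rewrite (coord_vbasis vU).
elim: (index_enum _) => [|i s IH]; first by rewrite big_nil phi0 sub0mx.
rewrite big_cons phi_lin addmx_sub // scalemx_sub //.
by apply: (eq_row_sub i); rewrite rowK.
Qed.

End Generators.

(** * Invariant forms on the even part *)

Section PeriplecticForm.
Variables (F : numFieldType) (n : nat).
Local Notation g0 := (periplectic_part F n false).

Lemma periplectic_even_mem (A : 'M[F]_n) : \tr A = 0 -> periplectic_even A \in g0.
Proof. by move=> trA; apply/mem_periplectic_even; exists A. Qed.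

Lemma periplectic_even_linear a (A A' : 'M[F]_n) :
  periplectic_even (a *: A + A') = a *: periplectic_even A + periplectic_even A'.
Proof.
rewrite /periplectic_even scale_block_mx add_block_mx !scaler0 !addr0.
by rewrite linearP opprD scalerN.
Qed.

Lemma superbr_even (A A' : 'M[F]_n) :
  superbr (periplectic_even A) (periplectic_even A')
    = periplectic_even (A *m A' - A' *m A).
Proof.
have ge (X : 'M[F]_n) : periplectic_even X \in gl_part F n false.
  by rewrite mem_gl_part /gl_proj block_mxKul block_mxKdr.
rewrite (superbrE (ge A) (ge A')) expr0 scale1r !mulmx_block.
rewrite !(mul0mx, mulmx0, addr0, add0r) opp_block_mx add_block_mx !oppr0 !addr0.
congr block_mx; rewrite linearB /= !trmx_mul !mulNmx !mulmxN !opprK.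
by rewrite opprB.
Qed.

Lemma superbr_odd (B C B' C' : 'M[F]_n) :
  superbr (block_mx 0 B C 0) (block_mx 0 B' C' 0)
    = block_mx (B *m C' + B' *m C) 0 0 (C *m B' + C' *m B).
Proof.
have go (X Y : 'M[F]_n) : block_mx 0 X Y 0 \in gl_part F n true.
  by rewrite mem_gl_part /gl_proj block_mxKur block_mxKdl.
rewrite (superbrE (go _ _) (go _ _)) expr1 scaleN1r opprK !mulmx_block.
by rewrite add_block_mx !(mul0mx, mulmx0, addr0, add0r).
Qed.

(** The form on sl(n) is extended to all matrices through the projection [tz] along the scalars.
    Commutators ignore scalars, so the extension [h] stays invariant and is a multiple of the trace
    form on traceless arguments. *)
Lemma invariant_form_trace (f : invariant_form (periplectic F n)) : (2 < n)%N ->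
  exists2 c, c != 0 & forall x y : 'M[F]_n, \tr x = 0 -> \tr y = 0 ->
    f (periplectic_even x) (periplectic_even y) = c * \tr (x *m y).
Proof.
move=> n_gt2.
have n0 : n%:R != 0 :> F by rewrite pnatr_eq0 -lt0n (ltn_trans _ n_gt2).
pose tz (x : 'M[F]_n) := x - (\tr x / n%:R)%:M.
have tz_tr x : \tr (tz x) = 0.
  by rewrite linearB /= mxtrace_scalar -(mulr_natr (_ / _)) divfK // subrr.
have tz_id x : \tr x = 0 -> tz x = x.
  by move=> trx; rewrite /tz trx mul0r -scalemx1 scale0r subr0.
have tz_lin a x y : tz (a *: x + y) = a *: tz x + tz y.
  rewrite /tz linearP /= mulrDl -mulrA raddfD /= -scale_scalar_mx scalerBr.
  by rewrite opprD addrACA.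
have tz_comm x y : tz x *m tz y - tz y *m tz x = x *m y - y *m x.
  rewrite /tz !mulmxBl !mulmxBr !mul_scalar_mx !mul_mx_scalar.
  apply/matrixP => i j; rewrite !mxE.
  by case: (i == j); rewrite ?mulr1n ?mulr0n; ring.
have tr_comm (x y : 'M[F]_n) : \tr (x *m y - y *m x) = 0.
  by rewrite linearB /= mxtrace_mulC subrr.
have pe0 x := periplectic_even_mem (tz_tr x).
pose h x y := f (periplectic_even (tz x)) (periplectic_even (tz y)).
have [a x x' y|a x y y'|x y z|c hc] := @invariant_bilinear_trace F n n_gt2 h.
- by rewrite /h tz_lin periplectic_even_linear form_linearl.
- by rewrite /h tz_lin periplectic_even_linear form_linearr.
- rewrite /h !(tz_id _ (tr_comm _ _)) -tz_comm -[in RHS]tz_comm -!superbr_even.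
  exact: form_invariant.
have fE (x y : 'M[F]_n) : \tr x = 0 -> \tr y = 0 ->
    f (periplectic_even x) (periplectic_even y) = c * \tr (x *m y).
  by move=> trx try; rewrite -hc // /h !tz_id.
exists c => //; apply/eqP => c0.
(* If [c] were 0, the traceless unit [delta_mx o0 o1] would give a nonzero element of the
   radical. *)
pose o0 : 'I_n := Ordinal (ltn_trans (isT : 0 < 2)%N n_gt2).
pose o1 : 'I_n := Ordinal (ltn_trans (isT : 1 < 2)%N n_gt2).
have tr01 : \tr (delta_mx o0 o1 : 'M[F]_n) = 0.
  rewrite /mxtrace big1 // => i _; rewrite mxE.
  by case: eqP => // ->.
have /(congr1 (fun X => ulsubmx X o0 o1)) :
    periplectic_even (delta_mx o0 o1) = 0 :> 'M[F]_(n + n).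
  apply: (@form_nondegenerate _ _ f _ (periplectic_even_mem tr01)).
  move=> y /mem_periplectic_even[A trA ->].
  by rewrite fE // c0 mul0r.
rewrite block_mxKul !mxE !eqxx => /eqP.
by rewrite oner_eq0.
Qed.

End PeriplecticForm.

(** * The bracket form on the odd part at a point of the orbit *)

Section OddForm.
Variables (F : numFieldType) (n : nat) (P J : 'M[F]_n).
Hypotheses (P_sym : P^T = P) (PP : P *m P = 1%:M) (PJ : P *m J = J^T *m P).
Local Notation g1 := (periplectic_part F n true).

(** Transposing under the trace and using [J *m P = P *m J^T], the terms pairing [S'] with [S] and
    [A'] with [A] cancel, while each mixed term occurs twice. *)
Lemma trace_odd_pairing (S A S' A' : 'M[F]_n) :
    S^T = S -> A^T = - A -> S'^T = S' -> A'^T = - A' ->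
  2 * (\tr (P *m S *m P *m A' *m J) + \tr (P *m S' *m P *m A *m J))
    = \tr (P *m (S' - A') *m P *m ((S + A) *m J - J^T *m (S + A))).
Proof.
move=> ST AT ST' AT'.
have JP : J *m P = P *m J^T.
  rewrite -[P *m J^T]mulmx1 -PP (mulmxA _ P) -(mulmxA P _ P) -PJ !mulmxA.
  by rewrite PP mul1mx.
have tS : \tr (P *m S' *m P *m (J^T *m S)) = \tr (P *m S' *m P *m (S *m J)).
  rewrite -mxtrace_tr !trmx_mul trmxK ST ST' P_sym mxtrace_mulC.
  by rewrite !mulmxA.
have tA : \tr (P *m S' *m P *m (J^T *m A)) = - \tr (P *m S' *m P *m (A *m J)).
  rewrite -mxtrace_tr !trmx_mul trmxK AT ST' P_sym !mulNmx linearN /=.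
  by rewrite mxtrace_mulC !mulmxA.
have tS' : \tr (P *m A' *m P *m (S *m J)) = - \tr (P *m S *m P *m A' *m J).
  transitivity (- \tr (J^T *m (S *m P *m A' *m P))).
    rewrite -mxtrace_tr !trmx_mul AT' ST P_sym mulNmx !mulmxN linearN /=.
    by rewrite !mulmxA.
  rewrite mxtrace_mulC -(mulmxA _ P J^T) -JP mulmxA mxtrace_mulC.
  by rewrite !mulmxA.
have tS'' : \tr (P *m A' *m P *m (J^T *m S)) = \tr (P *m S *m P *m A' *m J).
  rewrite mulmxA -(mulmxA _ P J^T) -JP mulmxA -(mulmxA _ P S) mxtrace_mulC.
  by rewrite !mulmxA.
have tA' : \tr (P *m A' *m P *m (J^T *m A)) = \tr (P *m A' *m P *m (A *m J)).
  rewrite -mxtrace_tr !trmx_mul trmxK AT AT' P_sym !(mulNmx, mulmxN) opprK.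
  by rewrite mxtrace_mulC !mulmxA.
rewrite -[P *m S' *m P *m A *m J]mulmxA.
rewrite [P *m (S' - A')]mulmxBr (mulmxBl _ _ P) (mulmxDl S A J) (mulmxDr J^T S A).
have trB (X Y : 'M[F]_n) : \tr (X - Y) = \tr X - \tr Y by rewrite linearB.
rewrite (mulmxBl (P *m S' *m P)) !mulmxBr !mulmxDr !(trB, mxtraceD).
rewrite tS tA tS' tS'' tA'; ring.
Qed.

Variable h : 'M[F]_n.
Hypothesis h_unit : h \in unitmx.
Local Notation hi := (invmx h).

(* Transports the odd element (B, C) by h and merges both blocks into one
   matrix with symmetric part P B P / 2 and skew part C / 2. *)
Definition odd_coord (v : 'M[F]_(n + n)) : 'M[F]_n :=
  2^-1 *: (P *m (hi *m ursubmx v *m hi^T) *m P + h^T *m dlsubmx v *m h).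

Lemma odd_coord_linear : linear odd_coord.
Proof.
move=> a v w; rewrite /odd_coord.
have -> : ursubmx (a *: v + w) = a *: ursubmx v + ursubmx w.
  by apply/matrixP => r c; rewrite !mxE.
have -> : dlsubmx (a *: v + w) = a *: dlsubmx v + dlsubmx w.
  by apply/matrixP => r c; rewrite !mxE.
rewrite !(mulmxDr, mulmxDl) -!(scalemxAr, scalemxAl).
rewrite scalerA mulrC -scalerA -scalerDr; congr (_ *: _).
by rewrite scalerDr addrACA.
Qed.

Lemma odd_coord_onto z : exists2 v, v \in g1 & odd_coord v = z.
Proof.
(* [B] and [C] undo the transport on [z + z^T] and [z - z^T], whose sum is [2 z]; the factor [2^-1]
   in [odd_coord] compensates. *)
pose B := h *m (P *m (z + z^T) *m P) *m h^T.
pose C := hi^T *m (z - z^T) *m hi.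
have hTi : h^T *m hi^T = 1%:M by rewrite -trmx_mul mulVmx ?trmx1.
exists (block_mx 0 B C 0).
  apply/mem_periplectic_odd; exists B, C; split=> //.
    by rewrite /B !trmx_mul linearD /= !trmxK P_sym addrC !mulmxA.
  by rewrite /C !trmx_mul linearB /= !trmxK -opprB mulmxA mulmxN mulNmx.
rewrite /odd_coord block_mxKur block_mxKdl /B /C !mulmxA hTi mul1mx !mulmxKV //.
rewrite -(mulmxA _ h^T) hTi mulmx1 PP mul1mx -mulmxA PP mulmx1 addrACA subrr addr0 -mulr2n -scaler_nat.
by rewrite scalerA mulVf ?scale1r // pnatr_eq0.
Qed.

(** Conjugation of [J] by [h] is absorbed by congruences on the two odd blocks, which reduces the
    form to the point [J]. The transpose on the right flips the skew part of [odd_coord w], as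
    [trace_odd_pairing] requires. *)
Lemma odd_coord_form (f : invariant_form (periplectic F n)) c v w :
    (forall x y : 'M[F]_n, \tr x = 0 -> \tr y = 0 ->
      f (periplectic_even x) (periplectic_even y) = c * \tr (x *m y)) ->
    \tr J = 0 -> v \in g1 -> w \in g1 ->
  f (superbr v w) (periplectic_even (h *m J *m hi))
    = 2 * c * \tr ((P *m odd_coord w *m P)^T
                   *m (odd_coord v *m J - J^T *m odd_coord v)).
Proof.
move=> fE trJ vg1 wg1.
have := superbr_periplectic vg1 wg1.
move: vg1 wg1 => /mem_periplectic_odd[B [C [BT CT ->]]].
move=> /mem_periplectic_odd[B' [C' [BT' CT' ->]]].
move=> /mem_periplectic_even[X trX XE].
have XBC : X = B *m C' + B' *m C.
  by have := congr1 ulsubmx XE; rewrite superbr_odd !block_mxKul.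
rewrite {}XE fE //; last by rewrite mxtrace_mulC mulmxA mulVmx ?mul1mx.
rewrite {}XBC /odd_coord !block_mxKur !block_mxKdl.
set S := P *m (hi *m B *m hi^T) *m P; set A := h^T *m C *m h.
set S' := P *m (hi *m B' *m hi^T) *m P; set A' := h^T *m C' *m h.
have symE (Y : 'M[F]_n) : Y^T = Y ->
    (P *m (hi *m Y *m hi^T) *m P)^T = P *m (hi *m Y *m hi^T) *m P.
  by move=> YT; rewrite !trmx_mul trmxK YT P_sym !mulmxA.
have skewE (Y : 'M[F]_n) : Y^T = - Y -> (h^T *m Y *m h)^T = - (h^T *m Y *m h).
  by move=> YT; rewrite !trmx_mul trmxK YT mulNmx mulmxN mulmxA.
have ST : S^T = S := symE _ BT.
have ST' : S'^T = S' := symE _ BT'.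
have AT : A^T = - A := skewE _ CT.
have AT' : A'^T = - A' := skewE _ CT'.
have hTi : hi^T *m h^T = 1%:M by rewrite -trmx_mul mulmxV ?trmx1.
have pairE (Y Z : 'M[F]_n) :
    \tr (P *m (P *m (hi *m Y *m hi^T) *m P) *m P *m (h^T *m Z *m h) *m J)
    = \tr (Y *m Z *m (h *m J *m hi)).
  rewrite !mulmxA PP mul1mx -(mulmxA _ P P) PP mulmx1 -(mulmxA _ hi^T) hTi mulmx1.
  by rewrite [RHS]mxtrace_mulC !mulmxA.
have := trace_odd_pairing ST AT ST' AT'; rewrite !pairE => E2.
rewrite mulmxDl mxtraceD.
have -> : (P *m (2^-1 *: (S' + A')) *m P)^T = 2^-1 *: (P *m (S' - A') *m P).
  rewrite -scalemxAr -scalemxAl linearZ /= !trmx_mul linearD /= ST' AT' P_sym.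
  by rewrite mulmxA.
rewrite -!(scalemxAr, scalemxAl) -scalerBr -!(scalemxAr, scalemxAl) !mxtraceZ -E2.
by field.
Qed.

End OddForm.

(** * The rank of the bracket matrix on the orbit, and the final count *)

Lemma trmx_mul_mxvec (F : fieldType) m n (Q Z : 'M[F]_(m, n)) :
  \tr (Q^T *m Z) = (mxvec Z *m (mxvec Q)^T) 0 0.
Proof.
rewrite mxE (reindex _ (curry_mxvec_bij m n)) /=.
transitivity (\sum_i \sum_j
    mxvec Z 0 (mxvec_index i j) * mxvec Q 0 (mxvec_index i j)); last first.
  by rewrite pair_bigA /=; apply: eq_bigr => -[i j] _; rewrite [in RHS]mxE.
rewrite /mxtrace exchange_big; apply: eq_bigr => j _; rewrite mxE; apply: eq_bigr => i _.
by rewrite !mxE !mxvecE mulrC.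
Qed.

(** By [odd_coord_form] the evaluated matrix is a nonzero multiple of
    [X *m (intertwining_mx F n mu *m Y^T)]. Since [odd_coord] is onto, [X] and [Y] have full column
    rank, so neither changes the rank. *)
Lemma rank_bracket_mx_orbit (F : numFieldType) n mu
    (f : invariant_form (periplectic F n.+1)) (h : 'M[F]_n.+1) :
    (2 < n.+1)%N -> sumn mu = n.+1 -> h \in unitmx ->
  \rank (map_mx (fun s => sym_fun f s
      (periplectic_even (h *m jordan_mx F n.+1 mu *m invmx h)))
    (bracket_mx (periplectic F n.+1))) = \rank (intertwining_mx F n mu).
Proof.
move=> n_gt2 mu_sum h_unit; set J := jordan_mx F n.+1 mu.
have [P [P_sym PP PJ]] := jordan_reversal F mu_sum.
have [c c0 fE] := invariant_form_trace f n_gt2.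
have trJ : \tr J = 0 := mxtrace_jordan F n.+1 mu.
set g := periplectic F n.+1.
pose x (v : g) : 'M[F]_n.+1 := odd_coord P h v.
pose X := \matrix_(i < \dim (lsa_part g true)) mxvec (x (vbasis (lsa_part g true))`_i).
pose Y := \matrix_(i < \dim (lsa_part g true))
  mxvec (P *m x (vbasis (lsa_part g true))`_i *m P).
have Xfull : row_full X.
  apply: (row_full_vbasis_image (phi := mxvec \o x)) => [a v w|z] /=.
    by rewrite /x odd_coord_linear linearP.
  have [v vg vz] := odd_coord_onto P_sym PP h_unit (vec_mx z).
  by exists v => //; rewrite /x vz vec_mxK.
have Yfull : row_full Y.
  apply: (row_full_vbasis_image (phi := fun v => mxvec (P *m x v *m P))) => [a v w|z] /=.
    by rewrite /x odd_coord_linear mulmxDr mulmxDl -scalemxAr -scalemxAl linearP.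
  have [v vg vz] := odd_coord_onto P_sym PP h_unit (P *m vec_mx z *m P).
  exists v => //; rewrite /x vz !mulmxA PP mul1mx -mulmxA PP mulmx1.
  by rewrite vec_mxK.
have -> : map_mx (fun s => sym_fun f s (periplectic_even (h *m J *m invmx h)))
    (bracket_mx g) = (2 * c) *: (X *m (intertwining_mx F n mu *m Y^T)).
  apply/matrixP => i j; rewrite !mxE.
  have vg (k : 'I_(\dim (lsa_part g true))) :
      (vbasis (lsa_part g true))`_k \in lsa_part g true.
    by apply: (@vbasis_mem _ _ _ (lsa_part g true)); rewrite mem_nth ?size_tuple.
  rewrite sym_fun_sym_of; first last.
  - by apply: periplectic_even_mem; rewrite mxtrace_mulC mulmxA mulVmx ?mul1mx.
  - exact: (lsa_br_part (vg i) (vg j)).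
  rewrite (odd_coord_form P_sym PP PJ h_unit fE trJ (vg i) (vg j)).
  rewrite trmx_mul_mxvec -mul_intertwining_mx -mulmxA; congr (_ * _).
  rewrite [LHS]mxE; apply: eq_bigr => k _; congr (_ * _); first by rewrite mxE.
  by rewrite !mxE; apply: eq_bigr => l _; rewrite !mxE.
rewrite mxrank_scale_nz ?mulf_neq0 ?pnatr_eq0 // eqmxMfull //.
by rewrite -mxrank_tr trmx_mul trmxK eqmxMfull // mxrank_tr.
Qed.

(* 1-based row i+1 and column i of J_mu are row i and column i-1 over 'I_n;    *)
(* the second equality is in int because nat subtraction is truncated.         *)
Theorem theorem3p9 (R : realType) (n : nat) (n_ge3 : (3 <= n)%N)
    (mu : seq nat) (mu_part : is_partition mu n)
    (B : invariant_form (periplectic R[i] n))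
    (b : nat -> bool)
    (b_subdiag : forall r c : 'I_n, r = c.+1 :> nat ->
       jordan_mx R[i] n mu r c = (b r)%:R) :
  k_even_orbit (mxtrace_jordan R[i] n mu) B
    = (2 * \sum_(1 <= i < n) (n - i) * b i)%N
  /\ ((2 * \sum_(1 <= i < n) (n - i) * b i)%N)%:Z
    = (n ^ 2)%N%:Z - (\sum_(1 <= i < n.+1) conj_part mu i ^ 2)%N%:Z.
Proof.
case: n n_ge3 mu_part B b_subdiag => // n n_ge3 /and3P[mu_s mu0 /eqP mu_sum] B b_sub.
(* With rows counted from 0, [b i] is the entry of [J] in row [i], column [i - 1], so it tells
   whether both indices lie in one block. *)
have b_pos i : (0 < i < n.+1)%N -> b i = (reshape_offset mu i != 0%N).
  case: i => // i /= i_lt.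
  pose r : 'I_n.+1 := Ordinal i_lt; pose c : 'I_n.+1 := Ordinal (ltnW i_lt).
  have <- : (reshape_index mu r == reshape_index mu c)
      && (reshape_offset mu r == (reshape_offset mu c).+1) = b r.
    have := b_sub r c erefl; rewrite jordan_mxE // => /eqP.
    by rewrite eqr_nat; case: (_ && _); case: (b r).
  have [r0|r0] := posnP (reshape_offset mu i.+1); first by rewrite r0 andbF.
  have iE : i = flatten_index mu (reshape_index mu r) (reshape_offset mu r).-1.
    by have := reshape_indexK mu r; rewrite /flatten_index /=; move: r0; lia.
  have r_lt : ((reshape_offset mu r).-1 < nth 0 mu (reshape_index mu r))%N.
    by have := pos_lt mu_sum r; lia.
  rewrite [in reshape_index mu c]/= [in reshape_offset mu c]/= iE.
  by rewrite flatten_indexKl // flatten_indexKr // prednK // !eqxx; move: r0; lia.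
have mu_le : all (geq n.+1) mu.
  apply/allP => a amu /=; rewrite -mu_sum sumnE.
  by rewrite (big_rem a amu) /= leq_addr.
have sum_b := sum_in_block mu_s mu0 mu_sum (ltn0Sn n) b_pos.
split; last by rewrite -sum_b (sum_minn_conj_part mu_le); lia.
rewrite /k_even_orbit; apply: k_orbit_rank => y [h dh ->].
rewrite rank_bracket_mx_orbit // ?unitmxE ?dh ?unitr1 //.
(* The rank and the weighted sum of the [b i] both complete the same sum of minima to [n.+1 ^ 2]. *)
have := rank_intertwining_mx R[i] mu_sum.
by rewrite (card_hankel_coords mu_sum) -sum_b => /addIn.
Qed.
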